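(* If $X$ is a finite set, then the $C$-algebra $\mathbb{3}^{X}$ is atomic.
   Context: $\mathbb{3}$ denotes McCarthy's three-valued $C$-algebra on $\{T,F,U\}$ with operations: $\neg T = F$, $\neg F = T$, $\neg U = U$; $T\wedge x = x$, $F \wedge x = F$, $U \wedge x = U$; $T \vee x = T$, $F \vee x = x$, $U \vee x = U$. $\mathbb{3}^{X}$ has pointwise operations with constants $\mathbf{T},\mathbf{F},\mathbf{U}$. Order: $a \leq b$ iff $a \vee b = b$. An atom is $a \neq \mathbf{F}$ such that every $b$ with $\mathbf{F}\leq b\leq a$, $b\neq a$ equals $\mathbf{F}$. For finitely many atoms $a_1,\dots,a_N$: if for every bijection $\sigma$ of $\{1,\dots,N\}$, $a_{\sigma(1)}\vee\cdots\vee a_{\sigma(N)} = a_1\vee\cdots\vee a_N$, then $\bigoplus_{i=1}^N a_i$ exists and equals this value. A $C$-algebra $M$ with $T,F,U$ is atomic if for every $a \in M$ with $a \neq F$ there is a finite set of atoms $\{a_1,\dots,a_N\}$ with $\bigoplus_{i=1}^N a_i$ existing and equal to $a$. *)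

(* Defs.v *)
From HB Require Import structures.
From mathcomp Require Import all_boot all_fingroup.
Set Implicit Arguments. Unset Strict Implicit. Unset Printing Implicit Defensive.

(* C-algebras with T, F, U: the first seven axioms are those of Guzman and
   Squier for C-algebras; the last five say that T is the identity of the
   conjunction, F that of the disjunction and U a fixed point of negation. *)
HB.mixin Record isCAlgebra (M : Type) := {
  cneg : M -> M;
  cand : M -> M -> M;
  cor : M -> M -> M;
  cT : M;
  cF : M;
  cU : M;
  cnegK : forall x, cneg (cneg x) = x;
  cneg_and : forall x y, cneg (cand x y) = cor (cneg x) (cneg y);
  candA : forall x y z, cand (cand x y) z = cand x (cand y z);
  cand_orr : forall x y z, cand x (cor y z) = cor (cand x y) (cand x z);
  cand_orl : forall x y z,
    cand (cor x y) z = cor (cand x z) (cand (cneg x) (cand y z));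
  cor_absorb : forall x y, cor x (cand x y) = x;
  cor_and_swap : forall x y,
    cor (cand x y) (cand y x) = cor (cand y x) (cand x y);
  candTx : forall x, cand cT x = x;
  candxT : forall x, cand x cT = x;
  corFx : forall x, cor cF x = x;
  corxF : forall x, cor x cF = x;
  cnegU : cneg cU = cU
}.

#[short(type="cAlgType")]
HB.structure Definition CAlgebra := { M of isCAlgebra M }.

Inductive three : Type := T3 | F3 | U3.

Definition three_neg (x : three) : three :=
  match x with T3 => F3 | F3 => T3 | U3 => U3 end.

Definition three_and (x y : three) : three :=
  match x with T3 => y | F3 => F3 | U3 => U3 end.

Definition three_or (x y : three) : three :=
  match x with T3 => T3 | F3 => y | U3 => U3 end.

Fact three_negK : forall x, three_neg (three_neg x) = x.
Proof. by case. Qed.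
Fact three_neg_and : forall x y,
  three_neg (three_and x y) = three_or (three_neg x) (three_neg y).
Proof. by do 2!case. Qed.
Fact three_andA : forall x y z,
  three_and (three_and x y) z = three_and x (three_and y z).
Proof. by do 3!case. Qed.
Fact three_and_orr : forall x y z,
  three_and x (three_or y z) = three_or (three_and x y) (three_and x z).
Proof. by do 3!case. Qed.
Fact three_and_orl : forall x y z,
  three_and (three_or x y) z =
    three_or (three_and x z) (three_and (three_neg x) (three_and y z)).
Proof. by do 3!case. Qed.
Fact three_or_absorb : forall x y, three_or x (three_and x y) = x.
Proof. by do 2!case. Qed.
Fact three_or_and_swap : forall x y,
  three_or (three_and x y) (three_and y x) = three_or (three_and y x) (three_and x y).
Proof. by do 2!case. Qed.
Fact three_andTx : forall x, three_and T3 x = x.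
Proof. by case. Qed.
Fact three_andxT : forall x, three_and x T3 = x.
Proof. by case. Qed.
Fact three_orFx : forall x, three_or F3 x = x.
Proof. by case. Qed.
Fact three_orxF : forall x, three_or x F3 = x.
Proof. by case. Qed.
Fact three_negU : three_neg U3 = U3.
Proof. by []. Qed.

HB.instance Definition _ := @isCAlgebra.Build three
  three_neg three_and three_or T3 F3 U3
  three_negK three_neg_and three_andA three_and_orr three_and_orl
  three_or_absorb three_or_and_swap
  three_andTx three_andxT three_orFx three_orxF three_negU.

Section Power.
Variables (X : finType) (M : cAlgType).
Implicit Types f g h : {ffun X -> M}.

Definition ffun_neg f : {ffun X -> M} := [ffun i => cneg (f i)].
Definition ffun_and f g : {ffun X -> M} := [ffun i => cand (f i) (g i)].
Definition ffun_or f g : {ffun X -> M} := [ffun i => cor (f i) (g i)].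
Definition ffun_T : {ffun X -> M} := [ffun=> cT].
Definition ffun_F : {ffun X -> M} := [ffun=> cF].
Definition ffun_U : {ffun X -> M} := [ffun=> cU].

Fact ffun_negK f : ffun_neg (ffun_neg f) = f.
Proof. by apply/ffunP => i; rewrite !ffunE cnegK. Qed.
Fact ffun_neg_and f g :
  ffun_neg (ffun_and f g) = ffun_or (ffun_neg f) (ffun_neg g).
Proof. by apply/ffunP => i; rewrite !ffunE cneg_and. Qed.
Fact ffun_andA f g h : ffun_and (ffun_and f g) h = ffun_and f (ffun_and g h).
Proof. by apply/ffunP => i; rewrite !ffunE candA. Qed.
Fact ffun_and_orr f g h :
  ffun_and f (ffun_or g h) = ffun_or (ffun_and f g) (ffun_and f h).
Proof. by apply/ffunP => i; rewrite !ffunE cand_orr. Qed.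
Fact ffun_and_orl f g h :
  ffun_and (ffun_or f g) h =
    ffun_or (ffun_and f h) (ffun_and (ffun_neg f) (ffun_and g h)).
Proof. by apply/ffunP => i; rewrite !ffunE cand_orl. Qed.
Fact ffun_or_absorb f g : ffun_or f (ffun_and f g) = f.
Proof. by apply/ffunP => i; rewrite !ffunE cor_absorb. Qed.
Fact ffun_or_and_swap f g :
  ffun_or (ffun_and f g) (ffun_and g f) = ffun_or (ffun_and g f) (ffun_and f g).
Proof. by apply/ffunP => i; rewrite !ffunE cor_and_swap. Qed.
Fact ffun_andTx f : ffun_and ffun_T f = f.
Proof. by apply/ffunP => i; rewrite !ffunE candTx. Qed.
Fact ffun_andxT f : ffun_and f ffun_T = f.
Proof. by apply/ffunP => i; rewrite !ffunE candxT. Qed.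
Fact ffun_orFx f : ffun_or ffun_F f = f.
Proof. by apply/ffunP => i; rewrite !ffunE corFx. Qed.
Fact ffun_orxF f : ffun_or f ffun_F = f.
Proof. by apply/ffunP => i; rewrite !ffunE corxF. Qed.
Fact ffun_negU : ffun_neg ffun_U = ffun_U.
Proof. by apply/ffunP => i; rewrite !ffunE cnegU. Qed.

HB.instance Definition _ := @isCAlgebra.Build {ffun X -> M}
  ffun_neg ffun_and ffun_or ffun_T ffun_F ffun_U
  ffun_negK ffun_neg_and ffun_andA ffun_and_orr ffun_and_orl ffun_or_absorb
  ffun_or_and_swap ffun_andTx ffun_andxT ffun_orFx ffun_orxF ffun_negU.
End Power.

Section Atomic.
Variable M : cAlgType.
Implicit Types a b x : M.

Definition cle a b : Prop := cor a b = b.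

Definition is_atom a : Prop :=
  a <> cF /\ forall b, cle cF b -> cle b a -> b <> a -> b = cF.

(* F is the two-sided identity of the associative operation cor, so this is
   the join of a_1, ..., a_N in this order, extended by the value
   F when N = 0. *)
Definition cjoin N (a : 'I_N -> M) : M := \big[@cor M/cF]_(i < N) a i.

(* The sum of a_1, ..., a_N exists and equals x. *)
Definition is_osum N (a : 'I_N -> M) x : Prop :=
  (forall s : 'S_N, cjoin (fun i => a (s i)) = cjoin a) /\ cjoin a = x.
End Atomic.

(* Injectivity of the family makes it an enumeration of the set {a_1, ..., a_N};
   N = 0 cannot occur here since the empty join is F. *)
Definition atomic (M : cAlgType) : Prop :=
  forall x : M, x <> cF ->
    exists (N : nat) (a : 'I_N -> M),
      injective a /\ (forall i, is_atom (a i)) /\ is_osum a x.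

(* Main.v *)
(** Below [a] in [3^X] lie only the [b] whose every value [b i] is [F] or [a i],
    so the atoms are the functions with a single value different from [F].  A
    function is the join, in any order, of its restrictions to the points of its
    support: at each point every term is [F] or the value of the function there,
    and [cor] is idempotent with unit [F]. *)
Require Import Defs.
From HB Require Import structures.
From mathcomp Require Import all_boot all_fingroup.
Set Implicit Arguments. Unset Strict Implicit. Unset Printing Implicit Defensive.

Lemma corxx (M : cAlgType) (x : M) : cor x x = x.
Proof. by rewrite -{2}[x]candxT cor_absorb. Qed.

(** [cor] is not commutative, but with a single value [v] besides the unit, idempotence makes the
    order of [r] irrelevant. *)
Lemma big_cor_if (M : cAlgType) (I : Type) (r : seq I) (p : pred I) (v : M) :
  \big[@cor M/cF]_(i <- r) (if p i then v else cF) = if has p r then v else cF.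
Proof.
elim: r => [|i r IHr]; first by rewrite big_nil.
rewrite big_cons IHr /=.
by case: (p i) (has p r) => [] [] /=; rewrite ?corxx ?corxF ?corFx.
Qed.

Section FiniteSupport.
Variables (X : finType) (M : cAlgType).
Implicit Types f g : {ffun X -> M}.

Lemma cor_ffunE f g j : (cor f g) j = cor (f j) (g j).
Proof. exact: ffunE. Qed.

Lemma cF_ffunE j : (cF : {ffun X -> M}) j = cF.
Proof. exact: ffunE. Qed.

Definition restrict1 f i : {ffun X -> M} := [ffun j => if i == j then f j else cF].

Lemma restrict1_id f i : restrict1 f i i = f i.
Proof. by rewrite ffunE eqxx. Qed.

Lemma restrict1_inj f i j : f i <> cF -> restrict1 f i = restrict1 f j -> i = j.
Proof.
move=> fi /ffunP/(_ i); rewrite restrict1_id ffunE eq_sym.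
by case: eqP.
Qed.

(** Since [e] only has to reach the support of [f], this covers all orderings of the terms at
    once. *)
Lemma cjoin_restrict1 f N (e : 'I_N -> X) :
    (forall j, f j = cF \/ exists k, e k = j) ->
  cjoin (fun k => restrict1 f (e k)) = f.
Proof.
move=> cov; apply/ffunP => j; rewrite /cjoin.
rewrite (big_morph (fun g : {ffun X -> M} => g j)
           (fun g h => cor_ffunE g h j) (cF_ffunE j)).
under eq_bigr => k _ do rewrite ffunE.
rewrite (big_cor_if _ (fun k => e k == j)).
case: ifPn => // /hasPn ne_ej.
case: (cov j) => [-> // | [k ekj]].
by have := ne_ej k (mem_index_enum k); rewrite ekj eqxx.
Qed.
End FiniteSupport.

(** [T3] and [U3] are left zeros of [cor]. *)
Lemma cle_three_cases (u v : three) : cle u v -> u = F3 \/ u = v.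
Proof. by case: u v => [] []; rewrite /cle /cor /=; auto. Qed.

Lemma restrict1_atom (X : finType) (f : {ffun X -> three}) i :
  f i <> F3 -> is_atom (restrict1 f i).
Proof.
move=> fi; split=> [/ffunP/(_ i)|b _ b_le b_neq].
  by rewrite restrict1_id cF_ffunE.
have b_cases j : b j = F3 \/ b j = restrict1 f i j.
  by apply: cle_three_cases; rewrite /cle -cor_ffunE b_le.
have b_off j : i != j -> b j = F3.
  by move=> /negPf ij; case: (b_cases j) => ->; rewrite // ffunE ij.
apply/ffunP => j; rewrite cF_ffunE.
have [<-{j}|/b_off //] := eqVneq i j.
(* If [b i] is not [F3], then [b] agrees with [restrict1 f i] everywhere, which [b_neq] excludes. *)
case: (b_cases i) => // bi; case: b_neq; apply/ffunP => j.
have [<- //|ij] := eqVneq i j.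
by rewrite b_off // ffunE (negPf ij).
Qed.

(** [three] carries no [eqType] structure here, so the support is cut out by this test. *)
Definition is_F3 (x : three) : bool := if x is F3 then true else false.

Lemma is_F3P (x : three) : reflect (x = F3) (is_F3 x).
Proof. by case: x; constructor. Qed.

Theorem theorem2p34 (X : finType) : atomic {ffun X -> three}.
Proof.
move=> f _; pose S := [set i | ~~ is_F3 (f i)].
have fS (k : 'I_#|S|) : f (enum_val k) <> F3.
  by apply/is_F3P; have := enum_valP k; rewrite inE.
have join_perm (s : 'S_#|S|) :
    cjoin (fun k => restrict1 f (enum_val (s k))) = f.
  apply: cjoin_restrict1 => j.
  have [/is_F3P|jS] := boolP (is_F3 (f j)); [by left | right].
  have {}jS : j \in S by rewrite inE.
  (* The index that [s] sends to the rank of [j] in [S]. *)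
  by exists (s^-1 (enum_rank_in jS j))%g; rewrite permKV enum_rankK_in.
have join : cjoin (fun k : 'I_#|S| => restrict1 f (enum_val k)) = f.
  rewrite -{2}(join_perm 1%g) /cjoin.
  by apply: eq_bigr => k _; rewrite perm1.
exists #|S|, (fun k => restrict1 f (enum_val k)); split.
  by move=> k l /(restrict1_inj (fS k)); apply: enum_val_inj.
split; first by move=> k; apply: restrict1_atom.
by split=> // s; rewrite join_perm join.
Qed.
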